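(* Suppose that $\mathcal{A} * \mathcal{X} = \mathcal{B}$ is consistent, let $\{\mathcal{X}^k\}$ be generated by the TKGK algorithm with truncation parameter $\tau$, and let $k$ be such that $\mathcal{A}*\mathcal{X}^k\ne\mathcal{B}$. Let $1\le\tilde\tau<\tau$ be an integer, $\tilde j_{k,\tilde\tau}:=\max\{k-\tilde\tau+1,0\}$, $$\tilde V_k:=[\vec{x}^{\tilde j_{k,\tilde\tau}}-\vec{x}^k,\dots,\vec{x}^{k-1}-\vec{x}^k],\qquad \tilde\beta_k:=\Big(1-\frac{\|\tilde V_k\tilde V_k^\dagger\vec{d}^k\|_2^2}{\|\vec{d}^k\|_2^2}\Big)^{-1}.$$ Then $\operatorname{Range}(\tilde V_k)\subseteq\operatorname{Range}(V_k)$, $$\frac{\|\tilde V_k\tilde V_k^\dagger\vec{d}^k\|_2^2}{\|\vec{d}^k\|_2^2}\le\frac{\|V_kV_k^\dagger\vec{d}^k\|_2^2}{\|\vec{d}^k\|_2^2},\qquad \tilde\beta_k\le\beta_k,\qquad 1-\tilde\beta_k\zeta_k^2\ge1-\beta_k\zeta_k^2 .$$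
   Context: Tensor notation. For $\mathcal{A}\in\mathbb{R}^{m\times \ell\times n}$ let $A_1,\dots,A_n$ be its frontal slices. $\operatorname{bcirc}(\mathcal{A})\in\mathbb{R}^{mn\times \ell n}$ is the block circulant matrix whose first block column is $A_1,\dots,A_n$ (top to bottom) and whose $(i,j)$ block is $A_{((i-j) \bmod n)+1}$. $\operatorname{unfold}(\mathcal{A})\in\mathbb{R}^{mn\times \ell}$ stacks $A_1,\dots,A_n$ vertically, and $\operatorname{fold}$ is its inverse. The $t$-product is $\mathcal{A} * \mathcal{Y} = \operatorname{fold}(\operatorname{bcirc}(\mathcal{A})\operatorname{unfold}(\mathcal{Y}))$. $\mathcal{A}^\dagger$ is the tensor with $\operatorname{bcirc}(\mathcal{A}^\dagger)=\operatorname{bcirc}(\mathcal{A})^\dagger$ (Moore-Penrose). $\mathcal{I}$ is the identity tensor (first frontal slice the identity matrix, others zero). $\langle\cdot,\cdot\rangle$ is the entrywise inner product, $\|\cdot\|_F$ the induced norm, $\|\cdot\|_2$ the Euclidean norm of vectors. $\operatorname{vec}(\mathcal{A})$ stacks the column-wise vectorizations of $A_1,\dots,A_n$. $\mathcal{A}_{i::}\in\mathbb{R}^{1\times \ell\times n}$ is the $i$th horizontal slice. Problem: $\mathcal{A}\in\mathbb{R}^{m\times\ell\times n}$, $\mathcal{B}\in\mathbb{R}^{m\times p\times n}$, unknown $\mathcal{X}\in\mathbb{R}^{\ell\times p\times n}$; $\mathcal{X}_*^0 = \mathcal{A}^\dagger * \mathcal{B} + (\mathcal{I} - \mathcal{A}^\dagger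 * \mathcal{A}) * \mathcal{X}^0$. Projections. $\mathcal{P}_i(\mathcal{X}) = \mathcal{X} - \mathcal{A}_{i::}^\dagger * (\mathcal{A}_{i::}*\mathcal{X} - \mathcal{B}_{i::})$. For a permutation $\pi_k=(\pi_{k,1},\dots,\pi_{k,m})$ of $[m]=\{1,\dots,m\}$, $\mathcal{P}_{\pi_k} = \mathcal{P}_{\pi_{k,m}}\circ\cdots\circ\mathcal{P}_{\pi_{k,1}}$, and $r_{\pi_k}(\mathcal{X})\in\mathbb{R}^{mn\ell\times p}$ is the vertical stacking over $i=1,\dots,m$ of the blocks $$\operatorname{unfold}\big(\mathcal{A}_{\pi_{k,i}::}^\dagger * (\mathcal{A}_{\pi_{k,i}::} * (\mathcal{P}_{\pi_{k,i-1}}\circ\cdots\circ\mathcal{P}_{\pi_{k,1}})(\mathcal{X}) - \mathcal{B}_{\pi_{k,i}::})\big)$$ (for $i=1$ the composition is the identity). Permutation strategies: incremental (IS): $\pi_k=(1,\dots,m)$ for all $k$; shuffle-once (SO): one random permutation $\pi_0$ drawn at the start and $\pi_k=\pi_0$ for all $k$; random reshuffling (RR): a fresh random permutation $\pi_k$ of $[m]$ at each $k$. TKGK algorithm. Input $\mathcal{A},\mathcal{B}$, integer $\tau\ge1$, $\mathcal{X}^0\in\mathbb{R}^{\ell\times p\times n}$, and a strategy in $\{\mathrm{IS},\mathrm{SO},\mathrm{RR}\}$. For $k=0,1,\dots$: generate $\pi_k$; set $\delta_k=\|\mathcal{P}_{\pi_k}(\mathcal{X}^k)-\mathcal{X}^k\|_F^2$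 and stop if $\delta_k=0$; set $\gamma_k=\tfrac12(\|r_{\pi_k}(\mathcal{X}^k)\|_F^2+\delta_k)$ and $j_{k,\tau}=\max\{k-\tau+1,0\}$; with $\vec{x}^i=\operatorname{vec}(\mathcal{X}^i)$, $\vec{d}^k=\operatorname{vec}(\mathcal{P}_{\pi_k}(\mathcal{X}^k)-\mathcal{X}^k)$ and $$M_k=[\vec{x}^{j_{k,\tau}}-\vec{x}^k,\dots,\vec{x}^{k-1}-\vec{x}^k,\vec{d}^k]\in\mathbb{R}^{\ell pn\times(k-j_{k,\tau}+1)},$$ let $s^k$ solve $M_k^\top M_k s^k=\gamma_k e$, where $e$ is the last standard basis vector of $\mathbb{R}^{k-j_{k,\tau}+1}$; set $$\mathcal{X}^{k+1}=\mathcal{X}^k+\sum_{i=1}^{k-j_{k,\tau}}s_i^k(\mathcal{X}^{j_{k,\tau}+i-1}-\mathcal{X}^k)+s^k_{k-j_{k,\tau}+1}(\mathcal{P}_{\pi_k}(\mathcal{X}^k)-\mathcal{X}^k).$$ Rate quantities (for $\mathcal{A}*\mathcal{X}^k\neq\mathcal{B}$). Let $V_k=[\vec{x}^{j_{k,\tau}}-\vec{x}^k,\dots,\vec{x}^{k-1}-\vec{x}^k]$. For a matrix $V$ with no columns, $VV^\dagger$ is the zero matrix and its range is $\{0\}$. Then $$\beta_k=\Big(1-\frac{\|V_kV_k^\dagger\vec{d}^k\|_2^2}{\|\vec{d}^k\|_2^2}\Big)^{-1},\qquad \zeta_k=\frac{\langle\mathcal{X}^k-\mathcal{X}_*^0,\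 \mathcal{X}^k-\mathcal{P}_{\pi_k}(\mathcal{X}^k)\rangle}{\|\mathcal{X}^k-\mathcal{X}_*^0\|_F\,\|\mathcal{P}_{\pi_k}(\mathcal{X}^k)-\mathcal{X}^k\|_F}.$$ The same iterates $\mathcal{X}^i$, the same $\pi_k$ and hence the same $\vec{d}^k$ and $\zeta_k$ are used for both $\tau$ and $\tilde\tau$. *)

(* Defs.v *)
From HB Require Import structures.
From mathcomp Require Import all_boot all_order all_algebra all_fingroup.
From mathcomp Require Import classical_sets reals.
Set Implicit Arguments.
Unset Strict Implicit.
Unset Printing Implicit Defensive.
Import Order.TTheory GRing.Theory Num.Theory.
Local Open Scope ring_scope.

(* Throughout, indices start at 0: "1, ..., m" is 'I_m. *)

Definition mxdot (R : realType) (m n : nat) (A B : 'M[R]_(m, n)) : R :=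
  \sum_i \sum_j A i j * B i j.

(* Frobenius norm; on column vectors it is the Euclidean norm. *)
Definition fnorm (R : realType) (m n : nat) (A : 'M[R]_(m, n)) : R :=
  Num.sqrt (mxdot A A).

(* MathComp's [pinvmx] is only a one-sided partial inverse, so the
   Moore-Penrose inverse is defined here, by the four Penrose conditions. *)
Definition penrose (R : realType) (m n : nat)
    (A : 'M[R]_(m, n)) (P : 'M[R]_(n, m)) : bool :=
  [&& A *m P *m A == A, P *m A *m P == P,
      (A *m P)^T == A *m P & (P *m A)^T == P *m A].

Lemma gram_unit (R : realType) (m n : nat) (F : 'M[R]_(m, n)) :
  row_free F -> F *m F^T \in unitmx.
Proof.
move=> freeF; rewrite -row_free_unit -kermx_eq0; apply/eqP.
set K := kermx _; have KF0 : (K *m F) *m (K *m F)^T = 0.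
  by rewrite trmx_mul mulmxA -(mulmxA K) mulmx_ker mul0mx.
have {}KF0 : K *m F = 0.
  apply/matrixP=> i j; rewrite mxE.
  move/matrixP/(_ i i): KF0; rewrite !mxE => /eqP.
  rewrite psumr_eq0 => [|t _]; last by rewrite [X in _ * X]mxE -expr2 sqr_ge0.
  move/allP/(_ j (mem_index_enum _))/implyP/(_ isT).
  by rewrite [X in _ * X]mxE -expr2 sqrf_eq0 mxE => /eqP.
by apply: (row_free_inj freeF); rewrite KF0 mul0mx.
Qed.

Lemma penrose_exists (R : realType) (m n : nat) (A : 'M[R]_(m, n)) :
  exists P, penrose A P.
Proof.
have := mulmx_base A; have := row_base_free A; have := col_base_full A.
move: (\rank A) (col_base A) (row_base A) => r C F fullC freeF defA.
have uF : F *m F^T \in unitmx by apply: gram_unit.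
have uC : C^T *m C \in unitmx.
  by rewrite -{2}[C]trmxK; apply: gram_unit; rewrite /row_free mxrank_tr.
set G := invmx (F *m F^T); set H := invmx (C^T *m C).
have sG : G^T = G by rewrite /G trmx_inv trmx_mul trmxK.
have sH : H^T = H by rewrite /H trmx_inv trmx_mul trmxK.
exists (F^T *m G *m (H *m C^T)).
have AP : A *m (F^T *m G *m (H *m C^T)) = C *m H *m C^T.
  rewrite -defA !mulmxA -(mulmxA C F) -(mulmxA C (F *m F^T)).
  by rewrite mulmxV // mulmx1.
have PA : F^T *m G *m (H *m C^T) *m A = F^T *m G *m F.
  rewrite -defA !mulmxA -(mulmxA _ C^T) -(mulmxA _ H (C^T *m C)).
  by rewrite mulVmx // mulmx1.
rewrite /penrose AP PA; apply/and4P; split; apply/eqP.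
- rewrite -{1}defA !mulmxA -(mulmxA _ C^T) -(mulmxA C H) mulVmx // mulmx1.
  exact: defA.
- rewrite !mulmxA -(mulmxA _ F) -(mulmxA _ G (F *m F^T)).
  by rewrite mulVmx // mulmx1.
- by rewrite !trmx_mul trmxK sH mulmxA.
- by rewrite !trmx_mul trmxK sG mulmxA.
Qed.

Lemma penrose_uniq (R : realType) (m n : nat) (A : 'M[R]_(m, n)) P Q :
  penrose A P -> penrose A Q -> P = Q.
Proof.
move=> /and4P[/eqP p1 /eqP p2 /eqP p3 /eqP p4].
move=> /and4P[/eqP q1 /eqP q2 /eqP q3 /eqP q4].
have AE : A *m P = A *m Q.
  rewrite -p3 -{1}q1 -mulmxA trmx_mul p3 q3.
  by rewrite mulmxA p1.
have EA : P *m A = Q *m A.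
  rewrite -p4 -{1}q1 -(mulmxA A Q A) mulmxA trmx_mul p4 q4.
  by rewrite -mulmxA (mulmxA A) p1.
by rewrite -p2 EA -mulmxA AE mulmxA.
Qed.

Definition mpinv (R : realType) (m n : nat) (A : 'M[R]_(m, n)) : 'M[R]_(n, m) :=
  xchoose (penrose_exists A).

Lemma mpinvP (R : realType) (m n : nat) (A : 'M[R]_(m, n)) :
  penrose A (mpinv A).
Proof. exact: xchooseP. Qed.

(* R^(m x l x (n+1)) as the finite sequence of frontal slices.  The third
   dimension is positive, so that 'I_n.+1 carries the group structure of
   Z/(n+1): below, [i - j] on slice indices is subtraction mod n+1. *)
Notation tensor R m l n := {ffun 'I_n.+1 -> 'M[R]_(m, l)}.

Definition bcirc (R : realType) (m l n : nat) (A : tensor R m l n) :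
    'M[R]_(\sum_(i < n.+1) m, \sum_(j < n.+1) l) :=
  \mxblock_(i < n.+1, j < n.+1) A (i - j).

Definition unfold (R : realType) (m l n : nat) (A : tensor R m l n) :
    'M[R]_(\sum_(i < n.+1) m, l) :=
  \mxcol_(i < n.+1) A i.

Definition fold (R : realType) (m l n : nat)
    (M : 'M[R]_(\sum_(i < n.+1) m, l)) : tensor R m l n :=
  [ffun i => submxcol M i].

Lemma unfoldK (R : realType) (m l n : nat) (A : tensor R m l n) :
  fold (unfold A) = A.
Proof. by apply/ffunP=> i; rewrite ffunE mxcolK. Qed.

Lemma foldK (R : realType) (m l n : nat) (M : 'M[R]_(\sum_(i < n.+1) m, l)) :
  unfold (fold M) = M.
Proof.
rewrite -[RHS]submxcolK; apply: eq_mxcol => i.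
by rewrite ffunE.
Qed.

Definition tprod (R : realType) (m l p n : nat)
    (A : tensor R m l n) (Y : tensor R l p n) : tensor R m p n :=
  fold (bcirc A *m unfold Y).

Notation "A ** Y" := (tprod A Y) (at level 40, left associativity) : ring_scope.

(* A block circulant matrix is determined by its first block column, whence
   the formula; [bcirc_tpinv] is the defining property of the t-pseudoinverse. *)
Definition tpinv (R : realType) (m l n : nat) (A : tensor R m l n) :
    tensor R l m n :=
  [ffun i => submxblock (mpinv (bcirc A)) i ord0].

(* Auxiliary to [bcirc_tpinv]: conjugation by a cyclic shift of the blocks. *)
Definition bshift (R : realType) (m l n : nat) (c : 'I_n.+1)
    (M : 'M[R]_(\sum_(i < n.+1) m, \sum_(j < n.+1) l)) :
    'M[R]_(\sum_(i < n.+1) m, \sum_(j < n.+1) l) :=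
  \mxblock_(i < n.+1, j < n.+1) submxblock M (i + c) (j + c).

Lemma bshift_bcirc (R : realType) (m l n : nat) c (A : tensor R m l n) :
  bshift c (bcirc A) = bcirc A.
Proof.
apply: eq_mxblock => i j; rewrite mxblockK.
by rewrite opprD addrACA subrr addr0.
Qed.

Lemma bshiftM (R : realType) (m l p n : nat) c
    (M : 'M[R]_(\sum_(i < n.+1) m, \sum_(j < n.+1) l))
    (N : 'M[R]_(\sum_(i < n.+1) l, \sum_(j < n.+1) p)) :
  bshift c (M *m N) = bshift c M *m bshift c N.
Proof.
rewrite /bshift mul_mxblock; apply: eq_mxblock => i j.
rewrite -{1}[M]submxblockK -{1}[N]submxblockK mul_mxblock mxblockK.
by rewrite (reindex_inj (addIr c)).
Qed.

Lemma bshiftT (R : realType) (m l n : nat) c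
    (M : 'M[R]_(\sum_(i < n.+1) m, \sum_(j < n.+1) l)) :
  (bshift c M)^T = bshift c M^T.
Proof.
rewrite /bshift tr_mxblock; apply: eq_mxblock => i j.
by apply/matrixP=> a b; rewrite !mxE.
Qed.

Lemma bcirc_tpinv (R : realType) (m l n : nat) (A : tensor R m l n) :
  bcirc (tpinv A) = mpinv (bcirc A).
Proof.
have shP c : bshift c (mpinv (bcirc A)) = mpinv (bcirc A).
  apply: (@penrose_uniq _ _ _ (bcirc A)); last exact: mpinvP.
  move: (mpinv _) (mpinvP (bcirc A)) (bshift_bcirc c A) => P.
  move: (bcirc A) => M /and4P[/eqP p1 /eqP p2 /eqP p3 /eqP p4] sM.
  apply/and4P; split; apply/eqP.
  - by rewrite -[in RHS]sM -[in RHS]p1 !bshiftM sM.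
  - by rewrite -[in RHS]p2 !bshiftM sM.
  - by rewrite -{1 2}sM -!bshiftM bshiftT p3.
  - by rewrite -{1 2}sM -!bshiftM bshiftT p4.
rewrite -[RHS]submxblockK; apply: eq_mxblock => i j.
by rewrite ffunE -[in RHS](shP (- j)) mxblockK subrr.
Qed.

Definition tid (R : realType) (m n : nat) : tensor R m m n :=
  [ffun i => if i == ord0 then 1%:M else 0].

Definition tdot (R : realType) (m l n : nat) (A B : tensor R m l n) : R :=
  \sum_t mxdot (A t) (B t).

Definition tnorm (R : realType) (m l n : nat) (A : tensor R m l n) : R :=
  Num.sqrt (tdot A A).

(* MathComp's [mxvec] is row-major: transposing each slice first gives its
   column-wise vectorization, and these are then laid end to end. *)
Definition vec (R : realType) (m l n : nat) (A : tensor R m l n) :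
    'cV[R]_(n.+1 * (l * m)) :=
  (mxvec (\matrix_(t < n.+1) mxvec (A t)^T))^T.

Definition hslice (R : realType) (m l n : nat) (A : tensor R m l n) (i : 'I_m) :
    tensor R 1 l n :=
  [ffun t => row i (A t)].

(* The increment subtracted by the i-th projection. *)
Definition pincr (R : realType) (m l p n : nat)
    (A : tensor R m l n) (B : tensor R m p n) (i : 'I_m) (X : tensor R l p n) :
    tensor R l p n :=
  tpinv (hslice A i) ** (hslice A i ** X - hslice B i).

Definition proj (R : realType) (m l p n : nat)
    (A : tensor R m l n) (B : tensor R m p n) (i : 'I_m) (X : tensor R l p n) :
    tensor R l p n :=
  X - pincr A B i X.

(* The first q projections, in the order pi 0, pi 1, ..., applied to X. *)
Definition projs (R : realType) (m l p n : nat)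
    (A : tensor R m l n) (B : tensor R m p n) (s : 'S_m) (q : nat)
    (X : tensor R l p n) : tensor R l p n :=
  foldl (fun Y i => proj A B (s i) Y) X (take q (enum 'I_m)).

Definition sweep (R : realType) (m l p n : nat)
    (A : tensor R m l n) (B : tensor R m p n) (s : 'S_m) (X : tensor R l p n) :
    tensor R l p n :=
  projs A B s m X.

Definition rstack (R : realType) (m l p n : nat)
    (A : tensor R m l n) (B : tensor R m p n) (s : 'S_m) (X : tensor R l p n) :
    'M[R]_(\sum_(i < m) \sum_(t < n.+1) l, p) :=
  \mxcol_(i < m) unfold (pincr A B (s i) (projs A B s i X)).

Inductive strategy := IS | SO | RR.

(* The permutation sequences a strategy can produce.  A uniform random draw
   can return any permutation, so each outcome is covered. *)
Definition admissible (m : nat) (st : strategy) (pi : nat -> 'S_m) : Prop :=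
  match st with
  | IS => forall k, pi k = 1%g
  | SO => forall k, pi k = pi 0%N
  | RR => True
  end.

(* max(k - tau + 1, 0): subtraction on nat is truncated. *)
Definition jstart (k tau : nat) : nat := (k.+1 - tau)%N.

Definition Vmx (R : realType) (l p n : nat) (X : nat -> tensor R l p n)
    (tau k : nat) : 'M[R]_(n.+1 * (p * l), k - jstart k tau) :=
  \matrix_(a, c) (vec (X (jstart k tau + c)%N) - vec (X k)) a 0.

Definition dvec (R : realType) (m l p n : nat)
    (A : tensor R m l n) (B : tensor R m p n) (s : 'S_m) (X : tensor R l p n) :
    'cV[R]_(n.+1 * (p * l)) :=
  vec (sweep A B s X - X).

Definition delta (R : realType) (m l p n : nat)
    (A : tensor R m l n) (B : tensor R m p n) (s : 'S_m) (X : tensor R l p n) :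
    R :=
  tnorm (sweep A B s X - X) ^+ 2.

Definition gamma (R : realType) (m l p n : nat)
    (A : tensor R m l n) (B : tensor R m p n) (s : 'S_m) (X : tensor R l p n) :
    R :=
  2^-1 * (fnorm (rstack A B s X) ^+ 2 + delta A B s X).

Definition Mmx (R : realType) (m l p n : nat)
    (A : tensor R m l n) (B : tensor R m p n) (pi : nat -> 'S_m)
    (X : nat -> tensor R l p n) (tau k : nat) :
    'M[R]_(n.+1 * (p * l), k - jstart k tau + 1) :=
  row_mx (Vmx X tau k) (dvec A B (pi k) (X k)).

(* Iteration k is executed in full: the stopping test fails and X k.+1 is
   computed from some solution s of the Gram system. *)
Definition tkgk_step (R : realType) (m l p n : nat)
    (A : tensor R m l n) (B : tensor R m p n) (tau : nat) (pi : nat -> 'S_m)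
    (X : nat -> tensor R l p n) (k : nat) : Prop :=
  delta A B (pi k) (X k) <> 0 /\
  exists s : 'cV[R]_(k - jstart k tau + 1),
    (Mmx A B pi X tau k)^T *m Mmx A B pi X tau k *m s
      = gamma A B (pi k) (X k) *: delta_mx (rshift (k - jstart k tau) ord0) 0 /\
    X k.+1 = X k
      + \sum_(i < k - jstart k tau)
          s (lshift 1 i) 0 *: (X (jstart k tau + i)%N - X k)
      + s (rshift (k - jstart k tau) ord0) 0 *: (sweep A B (pi k) (X k) - X k).

(* X 0, ..., X k are iterates of one run of the algorithm with initial point
   X0 (later values of X are unconstrained).  The run may stop at iteration k. *)
Definition tkgk_upto (R : realType) (m l p n : nat)
    (A : tensor R m l n) (B : tensor R m p n) (tau : nat)
    (X0 : tensor R l p n) (st : strategy) (pi : nat -> 'S_m)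
    (X : nat -> tensor R l p n) (k : nat) : Prop :=
  [/\ (1 <= tau)%N, admissible st pi, X 0%N = X0
    & forall i, (i < k)%N -> tkgk_step A B tau pi X i].

Definition Xstar (R : realType) (m l p n : nat)
    (A : tensor R m l n) (B : tensor R m p n) (X0 : tensor R l p n) :
    tensor R l p n :=
  tpinv A ** B + (tid R l n - tpinv A ** A) ** X0.

Definition beta (R : realType) (N q : nat) (V : 'M[R]_(N, q))
    (d : 'cV[R]_N) : R :=
  (1 - fnorm (V *m mpinv V *m d) ^+ 2 / fnorm d ^+ 2)^-1.

Definition zeta (R : realType) (m l p n : nat)
    (A : tensor R m l n) (B : tensor R m p n) (s : 'S_m)
    (X0 X : tensor R l p n) : R :=
  tdot (X - Xstar A B X0) (X - sweep A B s X)
    / (tnorm (X - Xstar A B X0) * tnorm (sweep A B s X - X)).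

(* The column space of V. *)
Definition mxrange (R : realType) (N q : nat) (V : 'M[R]_(N, q)) :
    set 'cV[R]_N :=
  [set V *m c | c in [set: 'cV[R]_q]]%classic.

(* Main.v *)
Require Import Defs.
From HB Require Import structures.
From mathcomp Require Import all_boot all_order all_algebra all_fingroup.
From mathcomp Require Import classical_sets reals.
From mathcomp Require Import lra.
Import Order.TTheory GRing.Theory Num.Theory.
Local Open Scope classical_set_scope.
Local Open Scope ring_scope.

(* Fix a solution Y.  Each projection moves its argument by an orthogonal
   projection of its difference to Y, so Pythagoras along one sweep gives
   <vec Y - x^k, d^k> = gamma_k, and gamma_k > 0 because X^k is not a solution.
   By induction, vec Y - x^k is orthogonal to Range(V_k): the Gram system says
   that x^(k+1) is the orthogonal projection of vec Y onto x^k + Range(M_k),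
   which contains all the columns used at step k+1.  Hence d^k is not in
   Range(V_k) and the denominator 1 - |V V^+ d|^2 / |d|^2 of beta_k is positive
   (at 0 Rocq's inverse would give beta_k = 0); the inequalities then follow
   from monotonicity of orthogonal projections. *)

(** * Entrywise inner product and orthogonal projectors *)

Lemma mxdotC {R : realType} {m n : nat} (A B : 'M[R]_(m, n)) :
  mxdot A B = mxdot B A.
Proof. by apply: eq_bigr => i _; apply: eq_bigr => j _; rewrite mulrC. Qed.

Lemma mxdotDl {R : realType} {m n : nat} (A B C : 'M[R]_(m, n)) :
  mxdot (A + B) C = mxdot A C + mxdot B C.
Proof.
rewrite /mxdot -big_split; apply: eq_bigr => i _.
by rewrite -big_split; apply: eq_bigr => j _; rewrite mxE mulrDl.
Qed.

Lemma mxdotNl {R : realType} {m n : nat} (A C : 'M[R]_(m, n)) :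
  mxdot (- A) C = - mxdot A C.
Proof.
rewrite /mxdot -sumrN; apply: eq_bigr => i _.
by rewrite -sumrN; apply: eq_bigr => j _; rewrite mxE mulNr.
Qed.

Lemma mxdotBl {R : realType} {m n : nat} (A B C : 'M[R]_(m, n)) :
  mxdot (A - B) C = mxdot A C - mxdot B C.
Proof. by rewrite mxdotDl mxdotNl. Qed.

Lemma mxdotDr {R : realType} {m n : nat} (A B C : 'M[R]_(m, n)) :
  mxdot A (B + C) = mxdot A B + mxdot A C.
Proof. by rewrite mxdotC mxdotDl !(mxdotC A). Qed.

Lemma mxdotBr {R : realType} {m n : nat} (A B C : 'M[R]_(m, n)) :
  mxdot A (B - C) = mxdot A B - mxdot A C.
Proof. by rewrite mxdotC mxdotBl !(mxdotC A). Qed.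

Lemma mxdot_tr {R : realType} {m n : nat} (A B : 'M[R]_(m, n)) :
  mxdot A B = \tr (A^T *m B).
Proof.
rewrite /mxdot exchange_big; apply: eq_bigr => j _.
by rewrite mxE; apply: eq_bigr => i _; rewrite mxE.
Qed.

Lemma mxdot_mulmxl {R : realType} {m n q : nat} (M : 'M[R]_(m, n))
    (A : 'M[R]_(n, q)) (B : 'M[R]_(m, q)) :
  mxdot (M *m A) B = mxdot A (M^T *m B).
Proof. by rewrite !mxdot_tr trmx_mul mulmxA. Qed.

Lemma mxdot_ge0 {R : realType} {m n : nat} (A : 'M[R]_(m, n)) :
  0 <= mxdot A A.
Proof. by do 2!apply: sumr_ge0 => ? _; rewrite -expr2 sqr_ge0. Qed.

Lemma mxdot_eq0 {R : realType} {m n : nat} (A : 'M[R]_(m, n)) :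
  (mxdot A A == 0) = (A == 0).
Proof.
apply/idP/eqP => [|->]; last by rewrite mxdot_tr mulmx0 mxtrace0.
rewrite psumr_eq0 => [/allP A0|i _]; last first.
  by apply: sumr_ge0 => j _; rewrite -expr2 sqr_ge0.
apply/matrixP=> i j; rewrite mxE; apply/eqP; rewrite -sqrf_eq0 expr2.
have := A0 i (mem_index_enum i); rewrite psumr_eq0 => [|c _]; last first.
  by rewrite -expr2 sqr_ge0.
by move/allP/(_ j (mem_index_enum j)).
Qed.

Lemma fnorm_sqr {R : realType} {m n : nat} (A : 'M[R]_(m, n)) :
  fnorm A ^+ 2 = mxdot A A.
Proof. by rewrite sqr_sqrtr // mxdot_ge0. Qed.

(** Pythagoras: symmetry and idempotence give <QW, QW> = <QW, W>, so [Q *m W] is orthogonal to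
    [W - Q *m W]. *)
Lemma mxdot_proj_compl {R : realType} {n q : nat} (Q : 'M[R]_n)
    (W : 'M[R]_(n, q)) :
  Q^T = Q -> Q *m Q = Q ->
  mxdot (W - Q *m W) (W - Q *m W) = mxdot W W - mxdot (Q *m W) (Q *m W).
Proof.
move=> sQ iQ; rewrite mxdotBl !mxdotBr (mxdotC W (Q *m W)).
have -> : mxdot (Q *m W) (Q *m W) = mxdot (Q *m W) W.
  by rewrite [LHS]mxdot_mulmxl sQ mulmxA iQ mxdotC.
by rewrite subrr subr0.
Qed.

Lemma mxdot_proj_le {R : realType} {n q : nat} (Q : 'M[R]_n)
    (W : 'M[R]_(n, q)) :
  Q^T = Q -> Q *m Q = Q -> mxdot (Q *m W) (Q *m W) <= mxdot W W.
Proof.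
by move=> sQ iQ; rewrite -subr_ge0 -mxdot_proj_compl // mxdot_ge0.
Qed.

(** * Projectors built from the Moore-Penrose inverse *)

Section MoorePenroseProjections.
Context {R : realType} {m n : nat} (V : 'M[R]_(m, n)).

Lemma mulmx_mpinv_sym : (V *m mpinv V)^T = V *m mpinv V.
Proof. by have /and4P[_ _ /eqP ? _] := mpinvP V. Qed.

Lemma mpinv_mulmx_sym : (mpinv V *m V)^T = mpinv V *m V.
Proof. by have /and4P[_ _ _ /eqP ?] := mpinvP V. Qed.

Lemma mulmx_mpinvK : V *m mpinv V *m V = V.
Proof. by have /and4P[/eqP ? _ _ _] := mpinvP V. Qed.

Lemma mulmx_mpinv_idem : (V *m mpinv V) *m (V *m mpinv V) = V *m mpinv V.
Proof. by rewrite mulmxA mulmx_mpinvK. Qed.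

Lemma mpinv_mulmx_idem : (mpinv V *m V) *m (mpinv V *m V) = mpinv V *m V.
Proof. by rewrite -mulmxA (mulmxA V) mulmx_mpinvK. Qed.

End MoorePenroseProjections.

(** Let P, P' be the orthogonal projectors onto the ranges of [V] and [V']. Since [V'] factors
    through [V], P P' = P'; transposing, P' P = P'. So P' d = P' (P d), and P' does not increase
    norms. *)
Lemma mxdot_mpinv_sub {R : realType} {N q r : nat} (V : 'M[R]_(N, q))
    (S : 'M[R]_(q, r)) (d : 'cV[R]_N) (V' := V *m S) :
  mxdot (V' *m mpinv V' *m d) (V' *m mpinv V' *m d)
    <= mxdot (V *m mpinv V *m d) (V *m mpinv V *m d).
Proof.
have PP' : (V *m mpinv V) *m (V' *m mpinv V') = V' *m mpinv V'.
  by rewrite !mulmxA mulmx_mpinvK.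
have P'P : (V' *m mpinv V') *m (V *m mpinv V) = V' *m mpinv V'.
  by rewrite -{1}(mulmx_mpinv_sym V') -(mulmx_mpinv_sym V) -trmx_mul PP'
             mulmx_mpinv_sym.
rewrite -P'P -mulmxA; apply: mxdot_proj_le.
- exact: mulmx_mpinv_sym.
- exact: mulmx_mpinv_idem.
Qed.

(** By Pythagoras the gap is the squared norm of d - V V^+ d; if it vanished, V^+ d would witness
    that [d] lies in the range. *)
Lemma mxdot_mpinv_lt {R : realType} {N q : nat} (V : 'M[R]_(N, q))
    (d : 'cV[R]_N) :
  ~ mxrange V d -> mxdot (V *m mpinv V *m d) (V *m mpinv V *m d) < mxdot d d.
Proof.
move=> dNV; rewrite -subr_gt0 -mxdot_proj_compl ?mulmx_mpinv_sym //; last first.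
  exact: mulmx_mpinv_idem.
rewrite lt0r mxdot_ge0 andbT mxdot_eq0 subr_eq0; apply/eqP=> dE; apply: dNV.
by exists (mpinv V *m d) => //; rewrite mulmxA -dE.
Qed.

(** * Tensors, their unfoldings and their vectorizations *)

Lemma unfoldB {R : realType} {m l n : nat} (A B : tensor R m l n) :
  unfold (A - B) = unfold A - unfold B.
Proof.
by rewrite /unfold -mxcolB; apply: eq_mxcol => i; rewrite !ffunE.
Qed.

Lemma unfold_tprod {R : realType} {m l p n : nat} (A : tensor R m l n)
    (Y : tensor R l p n) :
  unfold (A ** Y) = bcirc A *m unfold Y.
Proof. exact: foldK. Qed.

Lemma unfold_inj {R : realType} {m l n : nat} :
  injective (@unfold R m l n).
Proof. exact: can_inj (@unfoldK R m l n). Qed.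

Lemma tprodE {R : realType} {m l p n : nat} (A : tensor R m l n)
    (Y : tensor R l p n) t :
  (A ** Y) t = \sum_j A (t - j) *m Y j.
Proof. by rewrite ffunE /bcirc /unfold mul_mxblock_mxrow mxcolK. Qed.

Lemma hslice_tprod {R : realType} {m l p n : nat} (A : tensor R m l n)
    (Y : tensor R l p n) i :
  hslice (A ** Y) i = hslice A i ** Y.
Proof.
apply/ffunP=> t; rewrite ffunE !tprodE linear_sum; apply: eq_bigr => j _ /=.
by rewrite ffunE row_mul.
Qed.

Lemma hslice_inj {R : realType} {m l n : nat} (A B : tensor R m l n) :
  hslice A =1 hslice B -> A = B.
Proof.
move=> eAB; apply/ffunP=> t; apply/row_matrixP => i.
by have /ffunP/(_ t) := eAB i; rewrite !ffunE.
Qed.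

Lemma mxdot_mxcol {R : realType} {I p : nat} {q : 'I_I -> nat}
    (F G : forall i, 'M[R]_(q i, p)) :
  mxdot (\mxcol_i F i) (\mxcol_i G i) = \sum_i mxdot (F i) (G i).
Proof.
rewrite mxdot_tr tr_mxcol mul_mxrow_mxcol linear_sum; apply: eq_bigr => i _ /=.
by rewrite mxdot_tr.
Qed.

Lemma tdot_unfold {R : realType} {m l n : nat} (A B : tensor R m l n) :
  tdot A B = mxdot (unfold A) (unfold B).
Proof. by rewrite mxdot_mxcol. Qed.

Lemma tnorm_sqr {R : realType} {m l n : nat} (A : tensor R m l n) :
  tnorm A ^+ 2 = mxdot (unfold A) (unfold A).
Proof. by rewrite sqr_sqrtr tdot_unfold ?mxdot_ge0. Qed.

Lemma vecE {R : realType} {m l n : nat} (A : tensor R m l n) t i j :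
  vec A (mxvec_index t (mxvec_index j i)) 0 = A t i j.
Proof. by rewrite mxE mxvecE mxE mxvecE mxE. Qed.

Lemma vec_is_linear {R : realType} {m l n : nat} : linear (@vec R m l n).
Proof.
move=> a A B; apply/colP; case/mxvec_indexP=> t; case/mxvec_indexP=> j i.
rewrite [RHS]mxE [X in _ = X + _]mxE !vecE.
by rewrite ffunE mxE ffunE mxE.
Qed.

HB.instance Definition _ (R : realType) (m l n : nat) :=
  GRing.isLinear.Build R (tensor R m l n) _ _ _ (@vec_is_linear R m l n).

Lemma mxdot_trmx {R : realType} {m n : nat} (A B : 'M[R]_(m, n)) :
  mxdot A^T B^T = mxdot A B.
Proof.
rewrite /mxdot exchange_big; apply: eq_bigr => i _.
by apply: eq_bigr => j _; rewrite !mxE.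
Qed.

Lemma mxdot_mxvec {R : realType} {m n : nat} (A B : 'M[R]_(m, n)) :
  mxdot (mxvec A) (mxvec B) = mxdot A B.
Proof.
rewrite /mxdot big_ord1 (reindex _ (curry_mxvec_bij _ _)) /= pair_bigA.
by apply: eq_bigr => [[i j]] _ /=; rewrite !mxvecE.
Qed.

Lemma mxdot_vec {R : realType} {m l n : nat} (A B : tensor R m l n) :
  mxdot (vec A) (vec B) = tdot A B.
Proof.
rewrite mxdot_trmx mxdot_mxvec; apply: eq_bigr => t _.
rewrite -mxdot_trmx -mxdot_mxvec [RHS]big_ord1.
by apply: eq_bigr => j _; rewrite !mxE.
Qed.

(** * One sweep of projections, measured against a solution [Y] *)

Lemma unfold0 {R : realType} {m l n : nat} :
  unfold (0 : tensor R m l n) = 0.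
Proof. by rewrite -(subrr 0) unfoldB subrr. Qed.

(** Because the right-hand side is [A ** Y], the residual of slice [i] is [C i] applied to [Z - Y];
    the increment is thus the image of [Z - Y] under the orthogonal projector C^+ C. *)
Lemma unfold_pincr {R : realType} {m l p n : nat} (A : tensor R m l n)
    (Y Z : tensor R l p n) (C := fun i => bcirc (hslice A i)) i :
  unfold (pincr A (A ** Y) i Z) = mpinv (C i) *m C i *m unfold (Z - Y).
Proof.
rewrite unfold_tprod bcirc_tpinv !unfoldB hslice_tprod !unfold_tprod.
by rewrite -mulmxBr mulmxA.
Qed.

Lemma tdot_proj_sub {R : realType} {m l p n : nat} (A : tensor R m l n)
    (Y Z : tensor R l p n) i (B := A ** Y) :
  tdot (proj A B i Z - Y) (proj A B i Z - Y) =
  tdot (Z - Y) (Z - Y)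
    - mxdot (unfold (pincr A B i Z)) (unfold (pincr A B i Z)).
Proof.
rewrite /proj addrAC !tdot_unfold (unfoldB (Z - Y)) unfold_pincr.
rewrite mxdot_proj_compl ?mpinv_mulmx_sym //.
exact: mpinv_mulmx_idem.
Qed.

Lemma projsS {R : realType} {m l p n : nat} (A : tensor R m l n)
    (B : tensor R m p n) (s : 'S_m) (i : 'I_m) (X : tensor R l p n) :
  projs A B s i.+1 X = proj A B (s i) (projs A B s i X).
Proof.
rewrite /projs (take_nth i) ?size_enum_ord // nth_ord_enum.
by rewrite -cats1 foldl_cat.
Qed.

Lemma projs0 {R : realType} {m l p n : nat} (A : tensor R m l n)
    (B : tensor R m p n) (s : 'S_m) (X : tensor R l p n) :
  projs A B s 0 X = X.
Proof. by rewrite /projs take0. Qed.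

(** Each block of the stack accounts for the drop in squared distance to [Y] at one projection, and
    these drops telescope. *)
Lemma fnorm_rstack {R : realType} {m l p n : nat} (A : tensor R m l n)
    (X Y : tensor R l p n) (s : 'S_m) (B := A ** Y) :
  fnorm (rstack A B s X) ^+ 2 =
  tdot (X - Y) (X - Y) - tdot (sweep A B s X - Y) (sweep A B s X - Y).
Proof.
pose f q := - tdot (projs A B s q X - Y) (projs A B s q X - Y).
rewrite fnorm_sqr mxdot_mxcol.
transitivity (\sum_(i < m) (f i.+1 - f i)).
  apply: eq_bigr => i _.
  by rewrite /f projsS tdot_proj_sub opprK opprB addrNK.
rewrite -(big_mkord xpredT (fun i => f i.+1 - f i)) telescope_sumr //.
by rewrite /f projs0 opprK addrC.
Qed.

(** With d the sweep displacement and w = y - x, [fnorm_rstack] gives 2 gamma = |w|^2 - |d - w|^2 +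
    |d|^2 = 2 <d, w>. The right-hand side of the Gram system is therefore computable without knowing
    [Y]. *)
Lemma mxdot_dvec {R : realType} {m l p n : nat} (A : tensor R m l n)
    (X Y : tensor R l p n) (s : 'S_m) (B := A ** Y) :
  mxdot (dvec A B s X) (vec Y - vec X) = gamma A B s X.
Proof.
rewrite /gamma fnorm_rstack /delta tnorm_sqr -tdot_unfold -!mxdot_vec /dvec.
set S := sweep A _ s X; rewrite !linearB /=.
move: (vec S) (vec X) (vec Y) => u x y.
have -> : u - y = (u - x) + (x - y) by rewrite addrA addrNK.
move: (u - x) => d; rewrite -(opprB y x); move: (y - x) => w.
rewrite !(mxdotBr, mxdotDr, mxdotDl, mxdotNl) !(mxdotC _ (- w)) !mxdotNl.
rewrite (mxdotC w d).
lra.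
Qed.

Lemma gamma_gt0 {R : realType} {m l p n : nat} (A : tensor R m l n)
    (X Y : tensor R l p n) (s : 'S_m) (B := A ** Y) :
  A ** X <> B -> 0 < gamma A B s X.
Proof.
move=> AXB; rewrite /gamma pmulr_rgt0 ?invr_gt0 ?ltr0n // ltr_wpDr ?sqr_ge0 //.
rewrite fnorm_sqr lt0r mxdot_ge0 andbT mxdot_eq0; apply/eqP=> r0; apply: AXB.
have incr0 (i : 'I_m) : pincr A B (s i) (projs A B s i X) = 0.
  apply: unfold_inj; have := congr1 (fun M => submxcol M i) r0.
  rewrite /rstack mxcolK => ->.
  by rewrite unfold0; apply/matrixP=> a b; rewrite !mxE.
(* All increments vanish, so every partial sweep is still at [X], and each vanishing increment is
   one taken at [X] itself. *)
have projsX q : (q <= m)%N -> projs A B s q X = X.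
  elim: q => [|q IHq] ltqm; first exact: projs0.
  rewrite (projsS _ _ _ (Ordinal ltqm)) /proj incr0 subr0.
  exact: IHq (ltnW ltqm).
apply: hslice_inj => i; rewrite !hslice_tprod.
(* Slice [i] is visited at position s^-1 i of the sweep. *)
have := incr0 (s^-1 i)%g; rewrite permKV projsX 1?ltnW // => incri0.
apply/eqP; rewrite -subr_eq0 -(inj_eq unfold_inj) unfoldB !unfold_tprod.
(* Writing C = C C^+ C turns the residual C (X - Y) into C times the increment, which is zero. *)
rewrite -mulmxBr -unfoldB -[bcirc _]mulmx_mpinvK -!mulmxA [X in _ *m X]mulmxA.
rewrite -unfold_pincr incri0.
by rewrite !unfold0 mulmx0.
Qed.

(** * Orthogonality maintained along a run *)

Lemma Vmx_orthP {R : realType} {l p n : nat} (X : nat -> tensor R l p n)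
    (tau k : nat) w :
  (Vmx X tau k)^T *m w = 0 <->
  forall j, (jstart k tau <= j < k)%N -> mxdot (vec (X j) - vec (X k)) w = 0.
Proof.
split=> [Vw0 j /andP[lej ltj]|Xw0]; last first.
  apply/colP=> c; rewrite [RHS]mxE -(Xw0 (jstart k tau + c)%N).
    rewrite mxE; apply: eq_bigr => a _; rewrite big_ord1.
    by rewrite [X in X * _]mxE [X in X * _]mxE.
  by rewrite leq_addr -ltn_subRL ltn_ord.
have ltc : (j - jstart k tau < k - jstart k tau)%N.
  by rewrite ltn_sub2r // (leq_ltn_trans lej).
have /colP/(_ (Ordinal ltc)) := Vw0; rewrite [RHS]mxE => <-.
rewrite mxE; apply: eq_bigr => a _; rewrite big_ord1.
by rewrite [X in _ = X * _]mxE [X in _ = X * _]mxE /= subnKC.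
Qed.

Lemma jstart_leS k tau : (jstart k tau <= jstart k.+1 tau)%N.
Proof. exact: leq_sub2r. Qed.

(** Identifies the tensor update of the algorithm with a combination of the columns of M_k, so that
    the Gram system can be read as normal equations. *)
Lemma mulmx_Mmx {R : realType} {m l p n : nat} (A : tensor R m l n)
    (B : tensor R m p n) (pi : nat -> 'S_m) (X : nat -> tensor R l p n)
    (tau k : nat) s :
  Mmx A B pi X tau k *m s =
  vec (\sum_(i < k - jstart k tau)
          s (lshift 1 i) 0 *: (X (jstart k tau + i)%N - X k)
      + s (rshift (k - jstart k tau) ord0) 0 *: (sweep A B (pi k) (X k) - X k)).
Proof.
rewrite linearD linearZ linear_sum /=; apply/colP=> a.
rewrite mxE big_split_ord big_ord1 row_mxEr [RHS]mxE summxE; congr (_ + _).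
  by apply: eq_bigr => c _; rewrite row_mxEl mxE linearZ linearB !mxE mulrC.
by rewrite [RHS]mxE mulrC.
Qed.

Lemma Vmx_orth_sol {R : realType} {m l p n : nat} (A : tensor R m l n)
    (Y : tensor R l p n) (pi : nat -> 'S_m) (X : nat -> tensor R l p n)
    (tau k : nat) :
  (forall i, (i < k)%N -> tkgk_step A (A ** Y) tau pi X i) ->
  (Vmx X tau k)^T *m (vec Y - vec (X k)) = 0.
Proof.
elim: k => [|k IHk] run; first by apply/Vmx_orthP=> j; rewrite ltn0 andbF.
have [_ [s [Ms Xs]]] := run k (ltnSn k).
have {}IHk := IHk (fun i ltik => run i (ltnW ltik)).
have dXs : vec (X k.+1) - vec (X k) = Mmx A (A ** Y) pi X tau k *m s.
  by rewrite mulmx_Mmx -linearB Xs /= addrC -addrA addKr.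
(* The Gram right-hand side is M_k^T (y - x^k): the [Vmx] block vanishes by induction and the last
   entry is [mxdot_dvec]. Hence [s] solves the least-squares problem for y - x^k. *)
have gY : (Mmx A (A ** Y) pi X tau k)^T *m (vec Y - vec (X k)) =
    gamma A (A ** Y) (pi k) (X k)
      *: delta_mx (rshift (k - jstart k tau) ord0) 0.
  rewrite /Mmx tr_row_mx mul_col_mx IHk; apply/colP=> c; rewrite [RHS]mxE.
  rewrite [X in _ = _ * X]mxE andbT.
  case: (split_ordP c) => e ->; rewrite ?col_mxEu ?col_mxEd.
    by rewrite eq_lrshift mulr0 mxE.
  by rewrite !ord1 eqxx mulr1 -mxdot_dvec mxdot_tr /mxtrace big_ord1.
set w := vec Y - vec (X k.+1).
have subXS u : u - vec (X k.+1) = (u - vec (X k)) - (vec (X k.+1) - vec (X k)).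
  by rewrite opprB addrA subrK.
have Mw0 : (Mmx A (A ** Y) pi X tau k)^T *m w = 0.
  by rewrite /w subXS dXs mulmxBr gY mulmxA Ms subrr.
have sw0 : mxdot (vec (X k.+1) - vec (X k)) w = 0.
  by rewrite dXs mxdot_mulmxl Mw0 mxdot_tr mulmx0 mxtrace0.
have /Vmx_orthP Vw0 : (Vmx X tau k)^T *m w = 0.
  by move: Mw0; rewrite /Mmx tr_row_mx mul_col_mx -col_mx0 => /eq_col_mx[].
(* The new column j = k is minus the step M_k s. For j < k, the column is x^j - x^k minus that step,
   and x^j was already in the previous window since the window start never decreases. *)
apply/Vmx_orthP=> j /andP[lej]; rewrite ltnS leq_eqVlt => /orP[/eqP->|ltj].
  by rewrite subXS subrr sub0r mxdotNl sw0 oppr0.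
rewrite subXS mxdotBl sw0 subr0.
by rewrite Vw0 // (leq_trans (jstart_leS k tau) lej).
Qed.

(** A vector V_k c is orthogonal to y - x^k, whereas <d^k, y - x^k> = gamma_k > 0. *)
Lemma dvec_notin_range {R : realType} {m l p n : nat} (A : tensor R m l n)
    (Y : tensor R l p n) (pi : nat -> 'S_m) (X : nat -> tensor R l p n)
    (tau k : nat) :
  (forall i, (i < k)%N -> tkgk_step A (A ** Y) tau pi X i) ->
  A ** X k <> A ** Y ->
  ~ mxrange (Vmx X tau k) (dvec A (A ** Y) (pi k) (X k)).
Proof.
move=> /Vmx_orth_sol Vw0 AXB [c _ dE].
have := gamma_gt0 _ _ _ (pi k) AXB.
by rewrite -mxdot_dvec -dE mxdot_mulmxl Vw0 mxdot_tr mulmx0 mxtrace0 ltxx.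
Qed.

(** * Comparison of two truncation parameters *)

Lemma Vmx_sub {R : realType} {l p n : nat} (X : nat -> tensor R l p n)
    (tau tau' k : nat) :
  (tau' <= tau)%N -> exists S, Vmx X tau' k = Vmx X tau k *m S.
Proof.
move=> le_tau; have lej : (jstart k tau <= jstart k tau')%N by exact: leq_sub2l.
(* The shorter window is a final segment of the longer one; this 0/1 matrix selects its columns by
   matching absolute iterate indices. *)
exists (\matrix_(b, c) ((jstart k tau + b == jstart k tau' + c)%N)%:R).
apply/matrixP=> a c; rewrite [LHS]mxE [RHS]mxE.
have ltc : (jstart k tau' + c < k)%N by rewrite -ltn_subRL.
have ltb : (jstart k tau' + c - jstart k tau < k - jstart k tau)%N.
  by rewrite ltn_sub2r // (leq_ltn_trans _ ltc) // (leq_trans lej) ?leq_addr.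
have eqb : (jstart k tau + Ordinal ltb = jstart k tau' + c)%N.
  by rewrite subnKC // (leq_trans lej) ?leq_addr.
rewrite (bigD1 (Ordinal ltb)) //= big1 => [|b neq_b].
  by rewrite addr0 !mxE eqb eqxx mulr1.
rewrite [X in _ * X]mxE -eqb eqn_add2l.
by rewrite (_ : (_ == _) = false) ?mulr0 //; apply: negbTE neq_b.
Qed.

Theorem mainTheorem3 (R : realType) (m l p n : nat)
    (A : tensor R m l n) (B : tensor R m p n)
    (tau : nat) (X0 : tensor R l p n) (st : strategy) (pi : nat -> 'S_m)
    (X : nat -> tensor R l p n) (k : nat) (tau' : nat) :
  (exists Y : tensor R l p n, A ** Y = B) ->
  tkgk_upto A B tau X0 st pi X k ->
  A ** X k <> B ->
  (1 <= tau')%N -> (tau' < tau)%N ->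
  let V := Vmx X tau k in
  let V' := Vmx X tau' k in
  let d := dvec A B (pi k) (X k) in
  let z := zeta A B (pi k) X0 (X k) in
  [/\ mxrange V' `<=` mxrange V,
      fnorm (V' *m mpinv V' *m d) ^+ 2 / fnorm d ^+ 2
        <= fnorm (V *m mpinv V *m d) ^+ 2 / fnorm d ^+ 2,
      beta V' d <= beta V d
    & 1 - beta V' d * z ^+ 2 >= 1 - beta V d * z ^+ 2].
Proof.
move=> [Y <-] [_ _ _ run] AXB _ lt_tau V V' d z.
have [S V'S] := Vmx_sub X _ _ k (ltnW lt_tau).
have Pd_lt := mxdot_mpinv_lt _ _ (dvec_notin_range _ _ _ _ _ _ run AXB).
(* The strict bound |V V^+ d|^2 < |d|^2 already excludes d = 0, so the quotients are genuine. *)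
have d_gt0 : 0 < fnorm d ^+ 2.
  by rewrite fnorm_sqr (le_lt_trans (mxdot_ge0 _) Pd_lt).
have ratio_le : fnorm (V' *m mpinv V' *m d) ^+ 2 / fnorm d ^+ 2
    <= fnorm (V *m mpinv V *m d) ^+ 2 / fnorm d ^+ 2.
  by rewrite ler_pM2r ?invr_gt0 // !fnorm_sqr /V' V'S mxdot_mpinv_sub.
have ratio_lt1 : fnorm (V *m mpinv V *m d) ^+ 2 / fnorm d ^+ 2 < 1.
  by rewrite ltr_pdivrMr // mul1r !fnorm_sqr.
have beta_le : beta V' d <= beta V d.
  (* Inversion reverses order only between positive numbers: the ratio for [V] is below 1, and the
     one for [V'] is at most that. *)
  rewrite lef_pV2 ?posrE ?subr_gt0 ?lerB //.
  exact: le_lt_trans ratio_le ratio_lt1.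
split=> //; last by rewrite lerB // ler_wpM2r ?sqr_ge0.
by move=> _ [c _ <-]; exists (S *m c) => //; rewrite mulmxA -V'S.
Qed.
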